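(* Let $X$ be a real random variable with distribution $\mu$ and distribution function $F(x)=\mu((-\infty,x])$, and let $K_\mu(x,y)=F(x\wedge y)-F(x)F(y)$. Let $z\in\mathbb{R}$. Suppose that $b=b_1-b_2$ where $b_1,b_2$ are left-continuous and nondecreasing with either $b_j\in L_2(F)$ for $j=1,2$ or $b_j\in L_1(F)$ for $j=1,2$. Then $$F(z)\int_{\mathbb{R}}b\,dF-\int_{(-\infty,z]}b\,dF=-\mathrm{Cov}[1_{[X\le z]},b(X)]=\int_{\mathbb{R}}K_\mu(z,y)\,db(y),$$ and $$-(1-F(z))\int_{\mathbb{R}}b\,dF+\int_{(z,\infty)}b\,dF=\mathrm{Cov}[1_{[X>z]},b(X)]=\int_{\mathbb{R}}K_\mu(z,y)\,db(y).$$ Furthermore, if $b\in L_1(F)$ is absolutely continuous, then $$F(z)\int_{\mathbb{R}}b\,dF-\int_{(-\infty,z]}b\,dF=-\mathrm{Cov}[1_{[X\le z]},b(X)]=\int_{\mathbb{R}}K_\mu(z,y)\,b'(y)\,dy,$$ and $$-(1-F(z))\int_{\mathbb{R}}b\,dF+\int_{(z,\infty)}b\,dF=\mathrm{Cov}[1_{[X>z]},b(X)]=\int_{\mathbb{R}}K_\mu(z,y)\,b'(y)\,dy.$$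
   Context: $L_p(F)$ denotes $L_p$ of the probability measure $\mu$ with distribution function $F$. For $g$ nondecreasing and left-continuous, $dg$ denotes the associated Lebesgue–Stieltjes measure, $dg([\alpha,\beta))=g(\beta)-g(\alpha)$; for $b=b_1-b_2$ a difference of two such functions, $\int k\,db=\int k\,db_1-\int k\,db_2$.
   Formalization: In the ''Furthermore'' part, b is still assumed to be b_1−b_2 with b_j left-continuous, nondecreasing, both in L_2(F) or both in L_1(F); without this the integral of K_μ(z,y)b'(y) may not exist (b = sin, μ Cauchy, z = 0). *)

(* Defs.v *)
From HB Require Import structures.
From mathcomp Require Import all_boot all_order all_algebra.
From mathcomp Require Import all_classical all_reals all_analysis.

Set Implicit Arguments.
Unset Strict Implicit.
Unset Printing Implicit Defensive.

Import Order.TTheory GRing.Theory Num.Theory.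
Import numFieldNormedType.Exports.

Local Open Scope classical_set_scope.
Local Open Scope ring_scope.

Notation left_continuous g :=
  (forall x, g%function @ at_left x --> g%function x).

(* [lebesgue_stieltjes_measure] of the library expects a right-continuous
   function h and satisfies  ]a, b] |-> h b - h a.  For a left-continuous g
   we take h x := - g (- x), which is right-continuous, and transport the
   measure of h along x |-> - x. *)
Section lc_stieltjes.
Context {R : realType} (g : R -> R).
Hypotheses (g_nd : nondecreasing_fun g) (g_lc : left_continuous g).

Definition lc_reflect of nondecreasing_fun g & left_continuous g : R -> R :=
  fun x => - g (- x).

Let h : R -> R := lc_reflect g_nd g_lc.

Let h_nd : nondecreasing h.
Proof. by move=> x y xy; rewrite lerN2; apply: g_nd; rewrite lerN2. Qed.

Let h_rc : right_continuous h.
Proof.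
move=> x; apply: cvgN; apply/cvgrPdist_lt => e e0.
have /(@cvgrPdist_lt _ R^o) /(_ _ e0)[r /= r0 gr] := @g_lc (- x).
exists r => //= y xyr xy; apply: gr => /=; last by rewrite ltrN2.
by rewrite -opprD normrN.
Qed.

HB.instance Definition _ := isCumulative.Build R _ R (lc_reflect g_nd g_lc)
  h_nd h_rc.

Definition lc_stieltjes : set R -> \bar R :=
  pushforward (lebesgue_stieltjes_measure (lc_reflect g_nd g_lc))
    (-%R : R -> R).

Let mN : measurable_fun [set: measurableTypeR R] (-%R : R -> R).
Proof. exact: measurable_realfun.oppr_measurable. Qed.

Let lc_stieltjes0 : lc_stieltjes set0 = 0%E.
Proof. by rewrite /lc_stieltjes /pushforward preimage_set0 measure0. Qed.

Let lc_stieltjes_ge0 A : (0 <= lc_stieltjes A)%E.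
Proof. exact: measure_ge0. Qed.

Let lc_stieltjes_sigma_additive : semi_sigma_additive lc_stieltjes.
Proof.
exact: (@measure_semi_sigma_additive _ _ _
  (measure_function_pushforward__canonical__measure_function_Measure
    (lebesgue_stieltjes_measure (lc_reflect g_nd g_lc)) mN)).
Qed.

HB.instance Definition _ := isMeasure.Build _ _ _ lc_stieltjes
  lc_stieltjes0 lc_stieltjes_ge0 lc_stieltjes_sigma_additive.

Lemma lc_stieltjes_itv a b : a <= b ->
  lc_stieltjes `[a, b[ = (g b - g a)%:E.
Proof.
move=> ab; rewrite /lc_stieltjes /pushforward.
have -> : (-%R : R -> R) @^-1` `[a, b[%classic = `]- b, - a]%classic.
  apply/seteqP; split => x /=; rewrite !in_itv/=.
    by move=> /andP[ax xb]; rewrite ltrNl xb lerNr.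
  by move=> /andP[bx xa]; rewrite ltrNl bx lerNr xa.
rewrite /lebesgue_stieltjes_measure /measure_extension/=.
rewrite measurable_mu_extE/=; last exact: is_ocitv.
by rewrite wlength_itv_bnd ?lerN2// /lc_reflect !opprK addrC.
Qed.

End lc_stieltjes.

(* Integral of k with respect to db, where b = b1 - b2. *)
Definition int_dB {R : realType} (k : R -> \bar R) (b1 b2 : R -> R)
    (nd1 : nondecreasing_fun b1) (lc1 : left_continuous b1)
    (nd2 : nondecreasing_fun b2) (lc2 : left_continuous b2) : \bar R :=
  (\int[lc_stieltjes nd1 lc1]_y k y - \int[lc_stieltjes nd2 lc2]_y k y)%E.

Definition cov_kernel d (T : measurableType d) (R : realType)
    (P : probability T R) (X : {RV P >-> R}) (x y : R) : \bar R :=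
  (cdf X (Num.min x y) - cdf X x * cdf X y)%E.

Definition abs_continuous_itv {R : realType} (f : R -> R) (a b : R) : Prop :=
  forall e : R, 0 < e -> exists2 d : R, 0 < d &
  forall (n : nat) (u v : nat -> R),
    (forall i, (i < n)%N -> a <= u i /\ u i <= v i /\ v i <= b) ->
    trivIset `I_n (fun i => `]u i, v i[%classic) ->
    \sum_(i < n) (v i - u i) < d ->
    \sum_(i < n) `|f (v i) - f (u i)| < e.

(* On the whole line absolute continuity is required on every compact interval
   only, so that, e.g., the identity and x |-> x ^+ 2 qualify. *)
Definition abs_continuous {R : realType} (f : R -> R) : Prop :=
  forall a b : R, abs_continuous_itv f a b.

(* Main.v *)
(* Idea. With F the distribution function of X, set
     w(x, y) = (1 - F z) 1[x <= y < z] + F z 1[z <= y < x],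
   whose mean in x under mu is K_mu(z, y). If a sigma-finite measure m and a
   function g satisfy b v - b u = int_[u, v[ g dm, integrating w(x, y) g(y) in y
   first gives F z (b x - b z) - 1[x <= z] (b x - b z), so Fubini's theorem yields
     int K_mu(z, .) g dm = F z int b dmu - int_(-oo, z] b dmu.
   The Stieltjes case is g = 1, m = db_j; the absolutely continuous case is
   m = dy, g = b' almost everywhere. For the latter, absolute continuity of b
   forces db_1 - db_2 to vanish on Lebesgue-null sets (cover the set by finitely
   many disjoint intervals up to small db_j-measure), so db_1 - db_2 has a
   Radon-Nikodym density, and Lebesgue differentiation identifies it with b'. *)
Require Import Defs.
From HB Require Import structures.
From mathcomp Require Import all_boot all_order all_algebra.
From mathcomp Require Import all_classical all_reals all_analysis.
From mathcomp Require Import measurable_realfun ring lra.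
Import Order.TTheory GRing.Theory Num.Theory.
Import numFieldNormedType.Exports.
Local Open Scope classical_set_scope.
Local Open Scope ring_scope.
Set Implicit Arguments.
Unset Strict Implicit.
Unset Printing Implicit Defensive.

(** * Sigma-finiteness of the Stieltjes measures, as required by Fubini's theorem *)

Lemma lc_stieltjes_sigma_finite {R : realType} {g : R -> R}
    (nd : nondecreasing_fun g) (lc : left_continuous g) :
  sigma_finite setT (lc_stieltjes nd lc).
Proof.
exists (fun k => `[- k%:R, k%:R[%classic).
  apply/esym; rewrite -subTset => x _ /=.
  exists (Num.truncn `|x|).+1 => //=; rewrite in_itv/=.
  by have := truncnS_gt `|x|; rewrite ltr_norml => /andP[/ltW -> ->].
move=> k; split=> //; rewrite lc_stieltjes_itv ?ltry//.
by rewrite ge0_cp.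
Qed.

HB.instance Definition _ (R : realType) (g : R -> R)
    (nd : nondecreasing_fun g) (lc : left_continuous g) :=
  @Measure_isSigmaFinite.Build _ _ _ (lc_stieltjes nd lc)
    (lc_stieltjes_sigma_finite nd lc).

(** * The covariance kernel as a mean, and its integral by Fubini's theorem *)

Section kernel.
Local Open Scope ereal_scope.
Context {d} {T : measurableType d} {R : realType} {P : probability T R}.
Variables (X : {RV P >-> R}) (z : R).
Let mu : probability R R := distribution P X.

Let below : set (R * R) := [set xy | (xy.1 <= xy.2)%R /\ (xy.2 < z)%R].
Let above : set (R * R) := [set xy | (xy.2 < xy.1)%R /\ (z <= xy.2)%R].

Lemma ccdfE x : mu `]x, +oo[%classic = 1 - cdf X x.
Proof. by rewrite -setCitvl probability_setC. Qed.

(** The kernel factors according to the side of [z]: it is (1 - F z) F y for y < z, where the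
    section of [above] is empty, and F z (1 - F y) for z <= y, where the section of [below] is
    empty. *)
Lemma cov_kernelE y : cov_kernel X z y =
  (1 - cdf X z) * mu (ysection below y) + cdf X z * mu (ysection above y).
Proof.
rewrite /cov_kernel; have [yz|zy] := ltP y z.
- have -> : ysection below y = `]-oo, y]%classic.
    apply/seteqP; split=> x; rewrite /ysection/= inE/= in_itv/=; [by case|by []].
  have -> : ysection above y = set0.
    rewrite -subset0 => x; rewrite /ysection/= inE/= => -[_] /=.
    by rewrite leNgt yz.
  rewrite measure0 mule0 adde0 -/(cdf X y) muleBl ?mul1e//;
    by rewrite ?fin_num_adde_defr ?fin_num_measure.
- have -> : ysection below y = set0.
    rewrite -subset0 => x; rewrite /ysection/= inE/= => -[_] /=.
    by rewrite ltNge zy.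
  have -> : ysection above y = `]y, +oo[%classic.
    apply/seteqP; split=> x; rewrite /ysection/= inE/= in_itv/= andbT; [by case|by []].
  rewrite measure0 mule0 add0e ccdfE muleBr ?mule1//;
    by rewrite ?fin_num_adde_defr ?fin_num_measure.
Qed.

Let mbelow : measurable below.
Proof.
rewrite (_ : below = [set xy | (xy.1 <= xy.2)%R] `&`
    ([set: R] `*` `]-oo, z[%classic)); last first.
  by apply/seteqP; split=> -[x y]; rewrite /= in_itv/= => -[]// ? [].
apply: measurableI; last exact: measurableX.
by rewrite -[X in measurable X]setTI; exact: measurable_fun_le.
Qed.

Let mabove : measurable above.
Proof.
rewrite (_ : above = ~` [set xy | (xy.1 <= xy.2)%R] `&`
    ([set: R] `*` `[z, +oo[%classic)); last first.
  apply/seteqP; split=> -[x y]; rewrite /= in_itv/= andbT => -[].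
    by rewrite ltNge => /negP.
  by move=> /negP; rewrite -ltNge => ? [].
apply: measurableI; last exact: measurableX.
apply: measurableC.
by rewrite -[X in measurable X]setTI; exact: measurable_fun_le.
Qed.

Let f := fine (cdf X z).

Let fE : f%:E = cdf X z.
Proof. by rewrite fineK// fin_num_measure. Qed.

Let f01 : (0 <= f <= 1)%R.
Proof. by rewrite -!lee_fin fE cdf_ge0 cdf_le1. Qed.

Let w (xy : R * R) : R := ((1 - f) * \1_below xy + f * \1_above xy)%R.

Let mw : measurable_fun setT w.
Proof.
apply: measurable_funD; apply: measurable_funM => //; exact: measurable_indic.
Qed.

Let w_ge0 xy : (0 <= w xy)%R.
Proof.
have /andP[f0 f1] := f01.
by rewrite addr_ge0// mulr_ge0// ?subr_ge0.
Qed.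

Let w_le x y : (x <= z)%R -> w (x, y) = ((1 - f) * \1_(`[x, z[%classic) y)%R.
Proof.
move=> xz; rewrite /w [in X in (_ + X)%R]indicE memNset ?mulr0 ?addr0.
  by rewrite !indicE; congr (_ * (nat_of_bool _)%:R)%R; apply/idP/idP;
    rewrite !inE/= in_itv/= => /andP.
by move=> /= [yx zy]; move: (le_lt_trans zy yx); rewrite ltNge xz.
Qed.

Let w_gt x y : (z < x)%R -> w (x, y) = (f * \1_(`[z, x[%classic) y)%R.
Proof.
move=> zx; rewrite /w [in X in (X + _)%R]indicE memNset ?mulr0 ?add0r.
  rewrite !indicE; congr (_ * (nat_of_bool _)%:R)%R; apply/idP/idP;
    rewrite !inE/= in_itv/=.
  by move=> [-> ->].
  by move=> /andP[].
by move=> /= [xy yz]; move: (lt_trans (le_lt_trans xy yz) zx); rewrite ltxx.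
Qed.

Let integral_w y : \int[mu]_x (w (x, y))%:E = cov_kernel X z y.
Proof.
rewrite cov_kernelE -fE.
have mb : measurable (ysection below y) by exact: measurable_ysection.
have ma : measurable (ysection above y) by exact: measurable_ysection.
have -> : (fun x => (w (x, y))%:E) = (fun x =>
    (1 - f)%:E * (\1_(ysection below y) x)%:E +
    f%:E * (\1_(ysection above y) x)%:E).
  by apply/funext => x; rewrite -!EFinM -EFinD /w !indicE !mem_ysection.
have /andP[f0 f1] := f01.
rewrite ge0_integralD//=.
- rewrite !ge0_integralZl//=.
  + by rewrite !integral_indic// !setIT.
  + by apply/measurable_EFinP; exact: measurable_indic.
  + by apply/measurable_EFinP; exact: measurable_indic.
  + by rewrite lee_fin subr_ge0.
- by move=> x _; rewrite -EFinM lee_fin mulr_ge0// subr_ge0.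
- by apply: measurable_funeM; apply/measurable_EFinP; exact: measurable_indic.
- by move=> x _; rewrite -EFinM lee_fin mulr_ge0.
- by apply: measurable_funeM; apply/measurable_EFinP; exact: measurable_indic.
Qed.

(** [B] controls the variation of g dm; its integrability under [mu] supplies the absolute
    integrability that Fubini's theorem needs. In the Stieltjes case [B] is the integrator itself,
    in the absolutely continuous case it is b1 + b2. *)
Context {m : {sigma_finite_measure set R -> \bar R}} {g b B : R -> R}.
Hypotheses (mg : measurable_fun [set: R] g)
  (ib : mu.-integrable setT (EFin \o b)) (iB : mu.-integrable setT (EFin \o B))
  (gb : forall x y, (x <= y)%R -> m.-integrable `[x, y[ (EFin \o g) /\
    \int[m]_(t in `[x, y[) (g t)%:E = (b y - b x)%:E)
  (gB : forall x y, (x <= y)%R ->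
    \int[m]_(t in `[x, y[) `|g t|%:E <= (B y - B x)%:E).

Let H (xy : R * R) : \bar R := (w xy * g xy.2)%:E.

Let mH : measurable_fun setT H.
Proof.
apply/measurable_EFinP; apply: measurable_funM => //.
exact: measurableT_comp.
Qed.

(** For fixed x at most one term of [w] survives, on the half-open interval between x and [z]; [c]
    is its coefficient. *)
Let c x : R := (if (x <= z)%R then 1 - f else f)%R.

Let c01 x : (0 <= c x <= 1)%R.
Proof. by have := f01; rewrite /c; case: ifP => _ /andP[]; lra. Qed.

Let HE x y :
  H (x, y) = (c x)%:E * ((EFin \o g) \_ `[Num.min x z, Num.max x z[) y.
Proof.
rewrite /H /c patchE /=; case: leP => xz; [rewrite w_le//|rewrite w_gt//];
  by rewrite indicE; case: ifP => _; rewrite ?mulr1 ?mulr0 ?mul0r ?mule0 ?EFinM.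
Qed.

Let min_le_max x : (Num.min x z <= Num.max x z)%R.
Proof. by rewrite ge_min !le_max lexx. Qed.

Let mem_le x : (x \in `]-oo, z]%classic) = (x <= z)%R.
Proof. by apply/idP/idP; rewrite inE/= in_itv. Qed.

(** For x <= z the value (1 - f)(b z - b x) equals f (b x - b z) - (b x - b z), so one formula
    serves both sides of [z]. *)
Let integral_H x : \int[m]_y H (x, y) =
  (f * (b x - b z) - \1_(`]-oo, z]%classic) x * (b x - b z))%:E.
Proof.
have [ig gE] := gb (min_le_max x).
under eq_integral do rewrite HE.
rewrite integralZl//; last by rewrite -integrable_mkcond.
rewrite -integral_mkcond gE -EFinM /c indicE mem_le; congr EFin.
by case: leP => xz /=; rewrite ?mulr1n ?mulr0n; ring.
Qed.

Let integral_normH x : \int[m]_y `|H (x, y)| <= `|B x - B z|%:E.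
Proof.
have gBx := gB (min_le_max x).
under eq_integral do rewrite HE abseM.
have /andP[c0 c1] := c01 x.
rewrite ge0_integralZl//; last first.
  by apply: measurableT_comp => //; apply/(measurable_restrictT _ _).1 => //;
    exact/measurable_EFinP/measurable_funTS.
have -> : \int[m]_y `|((EFin \o g) \_ `[Num.min x z, Num.max x z[) y| =
    \int[m]_(y in `[Num.min x z, Num.max x z[) `|g y|%:E.
  rewrite [RHS]integral_mkcond; apply: eq_integral => y _.
  by rewrite !patchE; case: ifP => _; rewrite ?abse0.
rewrite gee0_abs ?lee_fin//.
apply: (@le_trans _ _ (\int[m]_(y in `[Num.min x z, Num.max x z[) `|g y|%:E)).
  by rewrite -[leRHS]mul1e lee_wpmul2r ?lee_fin// integral_ge0.
apply: (le_trans gBx); rewrite lee_fin.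
by case: (leP x z) => _; [rewrite distrC|]; exact: ler_norm.
Qed.

(** The inner integral of the absolute value is at most |B x - B z|, which is integrable because [B]
    is and [mu] is finite. *)
Let iH : (mu \x m).-integrable setT H.
Proof.
apply/integrable12ltyP => //.
have iBz : mu.-integrable setT (EFin \o (fun x => B x - B z)%R).
  apply: (@integrableB _ _ _ mu setT measurableT (EFin \o B) (cst (B z)%:E)) => //.
  exact: finite_measure_integrable_cst.
have /integrableP[mBz] := iBz; apply: le_lt_trans.
apply: ge0_le_integral => //.
- by move=> x _; exact: integral_ge0.
- apply: (measurable_fun_fubini_tonelli_F (abse \o H)) => //.
    exact: measurableT_comp.
  by move=> xy; exact: abse_ge0.
- exact: measurableT_comp.
Qed.

Lemma integral_cov_kernel :
  \int[m]_y (cov_kernel X z y * (g y)%:E) =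
  cdf X z * \int[mu]_x (b x)%:E - \int[mu]_(x in `]-oo, z]) (b x)%:E.
Proof.
transitivity (\int[m]_y \int[mu]_x H (x, y)).
  apply: eq_integral => y _; rewrite -integral_w.
  under [RHS]eq_integral do rewrite /H EFinM /=.
  (* Pulling out g y, whose sign is arbitrary, needs w(., y) integrable: its integral is the kernel,
     which is finite. *)
  rewrite integralZr//; apply/integrableP; split.
    by apply/measurable_EFinP; exact: measurableT_comp.
  under eq_integral do rewrite gee0_abs ?lee_fin//.
  by rewrite integral_w /cov_kernel ltey_eq fin_numB fin_numM ?fin_num_measure.
rewrite -Fubini//; under eq_integral do rewrite integral_H.
have ibz : mu.-integrable setT (fun x => (b x - b z)%:E).
  apply: (@integrableB _ _ _ mu setT measurableT (EFin \o b) (cst (b z)%:E)) => //.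
  exact: finite_measure_integrable_cst.
have ibz_le : mu.-integrable `]-oo, z]%classic (fun x => (b x - b z)%:E).
  exact: integrableS ibz.
transitivity (f%:E * \int[mu]_x (b x - b z)%:E -
    \int[mu]_(x in `]-oo, z]) (b x - b z)%:E).
  rewrite -integralZl// [X in _ - X]integral_mkcond -integralB//.
  - apply: eq_integral => x _; rewrite patchE indicE mem_le.
    by case: ifP => _; rewrite ?mul1r ?mul0r -?EFinM ?sube0 ?subr0// -EFinB.
  - exact: integrableZl.
  - by rewrite -integrable_mkcond.
have ib_le : mu.-integrable `]-oo, z]%classic (EFin \o b) by exact: integrableS ib.
have icst (D : set R) : measurable D -> mu.-integrable D (cst (b z)%:E).
  by move=> mD; exact: finite_measure_integrable_cst.
(* The two contributions of the constant b z are f * b z and b z * F z; they cancel since f = F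
   z. *)
rewrite (integralB (f2 := cst (b z)%:E) measurableT ib) ?icst//.
rewrite (integralB (f2 := cst (b z)%:E) (measurable_itv _) ib_le) ?icst//.
rewrite !integral_cst//= probability_setT -/(cdf X z) -fE.
have := integrable_fin_num measurableT ib.
have := integrable_fin_num (measurable_itv _) ib_le.
move: (integral _ _ _) (integral _ _ _) => [p| |] [q| |]// _ _.
by rewrite -!EFinM -?EFinD; congr EFin; ring.
Qed.

End kernel.

(** * Covariance of an indicator with an integrable function of [X] *)

Section covariance_indicator.
Local Open Scope ereal_scope.
Context {d} {T : measurableType d} {R : realType} {P : probability T R}.
Variables (X : {RV P >-> R}) (b : R -> R).
Let mu : probability R R := distribution P X.
Hypothesis ib : mu.-integrable setT (EFin \o b).

Let mb : measurable_fun [set: R] b.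
Proof. by apply/measurable_EFinP; exact: measurable_int ib. Qed.

Let ibX : P.-integrable setT (EFin \o (b \o X)).
Proof.
apply/integrableP; split.
  by apply/measurable_EFinP; exact: measurableT_comp.
have /integrableP[_] := ib.
rewrite ge0_integral_distribution//; apply: measurableT_comp => //.
exact/measurable_EFinP.
Qed.

(** Although [b] is only integrable, its product with the indicator is a restriction of [b \o X],
    hence integrable too, and the covariance expands as E[UV] - E[U] E[V]. *)
Lemma covariance_indic (D : set R) : measurable D ->
  covariance P \1_(X @^-1` D) (b \o X) =
  \int[mu]_(x in D) (b x)%:E - mu D * \int[mu]_x (b x)%:E.
Proof.
move=> mD.
have mXD : measurable (X @^-1` D) by exact: measurable_funPTI.
have prodE : (\1_(X @^-1` D) * (b \o X))%R = ((b \o X) \_ (X @^-1` D)).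
  apply/funext => t; rewrite patchE /= /GRing.mul/= indicE.
  by case: ifPn => _; rewrite ?mul1r ?mul0r.
have iXD : P.-integrable setT (EFin \o ((b \o X) \_ (X @^-1` D))).
  rewrite -restrict_EFin -integrable_mkcond//; exact: integrableS ibX.
rewrite covarianceE.
- rewrite prodE expectation_indic// unlock; congr (_ - _ * _).
  + rewrite [RHS]integral_pushforward//=; last 2 first.
    * exact/measurable_EFinP.
    * exact: integrableS ibX.
    rewrite [RHS]integral_mkcond; apply: eq_integral => t _.
    by rewrite restrict_EFin.
  + by rewrite integral_distribution//; exact/measurable_EFinP.
- by apply/Lfun1_integrable; exact: integrable_indic.
- exact/Lfun1_integrable.
- by rewrite prodE; exact/Lfun1_integrable.
Qed.

Let mufin D : measurable D -> \int[mu]_(x in D) (b x)%:E \is a fin_num.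
Proof. by move=> mD; apply: integrable_fin_num => //; exact: integrableS ib. Qed.

Lemma covariance_indic_le z :
  cdf X z * \int[mu]_x (b x)%:E - \int[mu]_(x in `]-oo, z]) (b x)%:E =
  - covariance P \1_[set t | (X t <= z)%R] (b \o X).
Proof.
rewrite (_ : [set t | _] = X @^-1` `]-oo, z]%classic); last first.
  by apply/seteqP; split=> t /=; rewrite in_itv.
rewrite covariance_indic// [RHS]fin_num_oppeB; first by rewrite [RHS]addeC.
by rewrite fin_numM ?fin_num_measure ?mufin.
Qed.

Lemma covariance_indic_gt z :
  - (1 - cdf X z) * \int[mu]_x (b x)%:E + \int[mu]_(x in `]z, +oo[) (b x)%:E =
  covariance P \1_[set t | (X t > z)%R] (b \o X).
Proof.
rewrite (_ : [set t | _] = X @^-1` `]z, +oo[%classic); last first.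
  by apply/seteqP; split=> t /=; rewrite in_itv/= andbT.
by rewrite covariance_indic// ccdfE mulNe addeC.
Qed.

(** The two indicators add up to 1, whose covariance with anything is 0; on the level of integrals,
    the integral of [b] splits at [z]. *)
Lemma covariance_indic_gtN z :
  covariance P \1_[set t | (X t > z)%R] (b \o X) =
  - covariance P \1_[set t | (X t <= z)%R] (b \o X).
Proof.
rewrite -covariance_indic_le -covariance_indic_gt.
have -> : \int[mu]_x (b x)%:E = \int[mu]_(x in `]-oo, z]) (b x)%:E +
    \int[mu]_(x in `]z, +oo[) (b x)%:E.
  rewrite -integral_setU//=.
  - by rewrite -setCitvl setUv.
  - by rewrite -setCitvl setUv; exact/measurable_EFinP.
  - by apply/disj_setPS => x []/=; rewrite !in_itv/= andbT leNgt => /negP.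
have : cdf X z \is a fin_num by rewrite fin_num_measure.
have := mufin (measurable_itv `]-oo, z]).
have := mufin (measurable_itv `]z, +oo[).
move: (cdf X z) (integral _ _ _) (integral _ _ _).
move=> [F| |] [A| |] [B| |] // _ _ _.
by rewrite -!EFinM -?EFinD; congr EFin; ring.
Qed.

End covariance_indicator.

(** * Agreement of two Stieltjes measures on Lebesgue-null sets *)

Lemma lebesgue_stieltjes_itv {R : realType} (h : cumulative R R) (a b : R) :
  a <= b -> lebesgue_stieltjes_measure h `]a, b]%classic = (h b - h a)%:E.
Proof.
move=> ab; rewrite /lebesgue_stieltjes_measure /measure_extension/=.
by rewrite measurable_mu_extE/= ?wlength_itv_bnd//; exact: is_ocitv.
Qed.

Section null_sets.
Context {R : realType}.
Variables (h1 h2 : cumulative R R).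
Let M1 := lebesgue_stieltjes_measure h1.
Let M2 := lebesgue_stieltjes_measure h2.

(** On finitely many disjoint intervals ]u, v] the difference of the measures is the sum of the
    increments of h1 - h2, which absolute continuity controls. *)
Lemma abs_continuous_finite_cover (a b e : R) : a <= b -> 0 < e ->
  abs_continuous_itv (fun x => h1 x - h2 x) a b ->
  exists2 r : R, 0 < r & forall B : set (set R), finite_set B ->
    trivIset B id -> (forall I, B I -> ocitv I /\ I `<=` `]a, b]) ->
    (lebesgue_measure (\bigcup_(I in B) I) < r%:E)%E ->
    (`| M1 (\bigcup_(I in B) I) - M2 (\bigcup_(I in B) I) | <= e%:E)%E.
Proof.
move=> ab e0 /(_ _ e0)[r r0 ac]; exists r => // B.
(* Without duplicates, distinct indices give distinct and therefore disjoint intervals. *)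
move=> /finite_seqP[s0 ->]; pose s := undup s0.
have -> : [set` s0] = [set` s].
  by apply/seteqP; split=> x /=; rewrite mem_undup.
pose n := size s; pose F i := nth set0 s i.
move=> tB Bab.
have tF : trivIset `I_n F.
  apply/trivIsetP => i j /= ni nj ij; move/trivIsetP : tB; apply.
  - exact: mem_nth.
  - exact: mem_nth.
  - by rewrite nth_uniq ?undup_uniq.
have BF : \bigcup_(I in [set` s]) I = \bigcup_(i in `I_n) F i.
  apply/seteqP; split=> x.
    by move=> [I /= /(nthP set0)[i ni <-] Ix]; exists i.
  by move=> [i /= ni Fx]; exists (F i) => //=; exact: mem_nth.
have /choice[p pP] : forall i, exists q : R * R, (i < n)%N ->
    [/\ a <= q.1, q.1 <= q.2, q.2 <= b & F i = `]q.1, q.2]%classic].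
  move=> i; have [ni|ni] := ltnP i n; last by exists (0, 0).
  have [/ocitvP[->|[[c d]/= cd ->]] Fab] := Bab (F i) (mem_nth _ ni).
    (* An empty member is written ]a, a], so that its endpoints still lie in [a, b]. *)
    exists (a, a) => _; split=> //=; by rewrite set_itv_ge// bnd_simp ltxx.
  exists (c, d) => _; split=> //=; first last.
  - have /Fab : `]c, d]%classic d by rewrite /= in_itv/= cd lexx.
    by rewrite /= in_itv/= => /andP[].
  - exact: ltW.
  (* If c < a, the point min(a, d) would lie in ]c, d] but not in ]a, b]. *)
  - rewrite leNgt; apply/negP => ca.
    have /Fab : `]c, d]%classic (Num.min a d).
      by rewrite /= in_itv/= lt_min ca cd ge_min lexx orbT.
    by rewrite /= in_itv/= lt_min ltxx.
have mF i : (i < n)%N -> measurable (F i).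
  by move=> /pP[_ _ _ ->].
have EM (m : {measure set (measurableTypeR R) -> \bar R}) :
    (m (\bigcup_(i in `I_n) F i) = \sum_(i < n) m (F i))%E.
  rewrite (measure_fin_bigcup m (finite_II n) tF)//.
  by rewrite -fsbig_ord.
have ELS (h : cumulative R R) :
    (lebesgue_stieltjes_measure h (\bigcup_(i in `I_n) F i) =
    (\sum_(i < n) (h (p i).2 - h (p i).1))%:E)%E.
  rewrite EM -sumEFin; apply: eq_bigr => i _.
  by have [_ pi _ ->] := pP i (ltn_ord i); exact: lebesgue_stieltjes_itv.
rewrite BF [X in (X < _)%E -> _]ELS [X in (_ -> `|X - _| <= _)%E]ELS.
rewrite [X in (_ -> `|_ - X| <= _)%E]ELS lte_fin -EFinB/= lee_fin => small.
have := ac n (fun i => (p i).1) (fun i => (p i).2) _ _ small.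
move=> /(_ _ _)/ltW; rewrite -sumrB => H.
apply: le_trans (H _ _).
- apply: le_trans (ler_norm_sum _ _ _) _; apply: ler_sum => i _.
  by rewrite le_eqVlt; apply/orP; left; apply/eqP; congr (`|_|); ring.
- by move=> i /pP[].
- apply/trivIsetP => i j ni nj ij; move/trivIsetP : tF => /(_ i j ni nj ij).
  have [_ _ _ ->] := pP i ni; have [_ _ _ ->] := pP j nj.
  rewrite -!subset0 => FIJ x [xi xj]; apply: (FIJ x).
  by split; [exact: subset_itv_oo_oc xi|exact: subset_itv_oo_oc xj].
Qed.

(* Its measure is the sum of the Lebesgue measure, [M1] and [M2], so that one
   cover by intervals is efficient for all three. *)
Let h x := x + h1 x + h2 x.

Let h_nd : nondecreasing h.
Proof.
by move=> x y xy; rewrite /h !lerD// cumulative_is_nondecreasing.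
Qed.

Let h_rc : right_continuous h.
Proof.
move=> x; apply: cvgD; last exact: cumulative_is_right_continuous.
apply: cvgD; last exact: cumulative_is_right_continuous.
exact: cvg_within.
Qed.

#[local] HB.instance Definition _ := isCumulative.Build R _ R h h_nd h_rc.
Let M := lebesgue_stieltjes_measure h.

(** Both sides agree on the intervals ]a, b], which determine a Stieltjes measure. *)
Let ME A : measurable A -> M A = (lebesgue_measure A + M1 A + M2 A)%E.
Proof.
move=> mA.
pose N := measure_add (measure_add lebesgue_measure M1) M2.
have NE B : (N B = lebesgue_measure B + M1 B + M2 B)%E.
  by rewrite /N measure_addE; congr (_ + _)%E; exact: measure_addE.
rewrite -NE; apply: lebesgue_stieltjes_measure_unique => //.
move=> _ [[a b] _ <-] /=; apply: (eq_trans _ (esym (NE _))).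
have [ab|ba] := leP a b.
  rewrite [LHS](lebesgue_stieltjes_itv _ ab).
  rewrite [X in (X + _ + _)%E](lebesgue_stieltjes_itv idfun ab).
  rewrite [X in (_ + X + _)%E](lebesgue_stieltjes_itv _ ab).
  rewrite [X in (_ + _ + X)%E](lebesgue_stieltjes_itv _ ab).
  rewrite -!EFinD; congr EFin; rewrite /= /h; ring.
have -> : `]a, b]%classic = set0 by rewrite set_itv_ge// bnd_simp -leNgt ltW.
by rewrite [LHS]measure0 /M1 /M2 !measure0 !adde0.
Qed.

(** A countable union U of intervals covers A with D = U \ A small for all three measures. As A is
    null, U has small Lebesgue measure, so its finite subunions obey the previous bound, and
    continuity from below carries the bound to U. Then |M1 A - M2 A| <= |M1 U - M2 U| + |M1 D - M2
    D|. *)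
Lemma stieltjes_abs_continuous_null (a b : R) (A : set R) : a <= b ->
  abs_continuous_itv (fun x => h1 x - h2 x) a b ->
  measurable A -> A `<=` `]a, b] -> lebesgue_measure A = 0%E -> M1 A = M2 A.
Proof.
move=> ab ac mA Aab A0.
have Lfin (g : cumulative R R) (B : set R) : measurable B -> B `<=` `]a, b] ->
    lebesgue_stieltjes_measure g B \is a fin_num.
  move=> mB Bab; rewrite ge0_fin_numE//.
  apply: (@le_lt_trans _ _ (lebesgue_stieltjes_measure g `]a, b]%classic)).
    by apply: le_measure; rewrite ?inE.
  by rewrite lebesgue_stieltjes_itv// ltry.
suff H e : 0 < e -> (`|M1 A - M2 A| <= (e + e)%:E)%E.
  have := Lfin h1 _ mA Aab; have := Lfin h2 _ mA Aab; move: H; rewrite -/M1 -/M2.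
  move: (M1 A) (M2 A) => [x| |] [y| |]// H _ _; congr EFin; apply/eqP.
  rewrite -subr_eq0 -normr_le0 leNgt; apply/negP => xy.
  (* With this value of e the bound e + e is half of |x - y|, a contradiction. *)
  have {}xy : 0 < `|x - y| / 4 by rewrite divr_gt0.
  by have := H _ xy; rewrite -EFinB lee_fin; lra.
move=> e0; have [r r0 acr] := abs_continuous_finite_cover ab e0 ac.
(* The bound by e serves [M1] and [M2] of D in the final estimate; the bound by r makes U short
   enough for [acr]. *)
pose eps := Num.min e r.
have eps0 : 0 < eps by rewrite lt_min e0.
(* [M A] is by construction the infimum of C, so a nearly optimal cover exists. *)
pose C := [set (\sum_(k <oo) wlength h (F k))%E |
  F in @measurable_cover _ (ocitv_type R) A].
have Cfin : ereal_inf C \is a fin_num by exact: (Lfin h _ mA Aab).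
have [_ [I [mI AI] <-] Ilt] := lb_ereal_inf_adherent eps0 Cfin.
rewrite -/(M A) in Ilt.
pose J k := I k `&` `]a, b]%classic.
have oJ k : ocitv (J k) by apply: ocitvI; [exact: mI|exact: is_ocitv].
have mJ k : measurable (J k : set (measurableTypeR R)).
  by apply: sub_sigma_algebra; exact: oJ.
pose U := \bigcup_k J k.
have mU : measurable (U : set (measurableTypeR R)) by exact: bigcup_measurable.
have Uab : U `<=` `]a, b] by move=> x [k _ []].
have AU : A `<=` U.
  by move=> x Ax; have [k _ Ix] := AI _ Ax; exists k => //; split => //; exact: Aab.
have MU : (M U < M A + eps%:E)%E.
  apply: le_lt_trans Ilt.
  apply: (@le_trans _ _ (\sum_(k <oo) M (J k))%E).
    by apply: (@measure_sigma_subadditive _ _ _ M) => //; exact: mJ.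
  apply: lee_nneseries => // k _.
  rewrite -(measurable_mu_extE (wlength h) (mI k)).
  by apply: (@le_outer_measure R _ (mu_ext (wlength h))); exact: subIsetl.
pose D := U `\` A.
have mD : measurable (D : set (measurableTypeR R)) by exact: measurableD.
have UE (g : cumulative R R) : (lebesgue_stieltjes_measure g U =
    lebesgue_stieltjes_measure g D + lebesgue_stieltjes_measure g A)%E.
  by rewrite (measureDI _ mU mA); congr (_ + lebesgue_stieltjes_measure g _)%E;
    exact/setIidr.
have MD : (lebesgue_measure D + M1 D + M2 D < eps%:E)%E.
  by rewrite -ME// -(lteD2lE _ _ Cfin) addeC; move: MU; rewrite /M UE.
have Dle (x y w t : \bar R) : (0 <= x -> 0 <= y -> 0 <= w -> x + y + w < t ->
    [/\ x < t, y < t & w < t])%E.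
  move=> x0 y0 w0 xt; split; apply: le_lt_trans xt.
  - by rewrite -addeA leeDl// adde_ge0.
  - by rewrite addeAC leeDr// adde_ge0.
  - by rewrite leeDr// adde_ge0.
have [LD M1D M2D] := Dle _ _ _ _ (measure_ge0 lebesgue_measure D)
  (measure_ge0 M1 D) (measure_ge0 M2 D) MD.
have LU : (lebesgue_measure U < r%:E)%E.
  rewrite /lebesgue_measure UE -/lebesgue_measure A0 adde0.
  by rewrite (lt_le_trans LD)// lee_fin /eps ge_min lexx orbT.
pose E n := \big[setU/set0]_(k < n.+1) J k.
have EU n : E n `<=` U.
  by rewrite /E -bigcup_mkord => x [k _ Jx]; exists k.
have mE n : measurable (E n : set (measurableTypeR R)).
  exact: bigsetU_measurable.
have small n : (`|M1 (E n) - M2 (E n)| <= e%:E)%E.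
  have mrE : measurable (E n : set (SetRing.type (ocitv_type R))).
    by apply: bigsetU_measurable => k _; apply: SetRing.measurable_subring; exact: oJ.
  (* The intervals [J k] may overlap; the decomposition in the ring of sets turns [E n] into
     finitely many disjoint half-open intervals. *)
  pose B : set (set R) := @SetRing.decomp _ (ocitv_type R) (E n).
  have BE : \bigcup_(K in B) K = E n := @SetRing.cover_decomp _ (ocitv_type R) (E n).
  rewrite -BE; apply: acr.
  - exact: (@SetRing.decomp_finite_set _ (ocitv_type R) (E n)).
  - exact: (@SetRing.decomp_triv _ (ocitv_type R) (E n)).
  - move=> K KE; split.
      by apply: (@SetRing.decomp_measurable _ (ocitv_type R) (E n)); rewrite ?inE.
    by apply: (subset_trans _ Uab); apply: (subset_trans _ (EU n));
      apply: (@SetRing.decomp_sub _ (ocitv_type R) (E n)); rewrite inE.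
  - rewrite BE; apply: le_lt_trans LU.
    by apply: le_measure; rewrite ?inE.
have UeE : \bigcup_n E n = U by exact: bigcup_bigsetU_bigcup.
have cvgE (g : cumulative R R) : (lebesgue_stieltjes_measure g \o E @ \oo -->
    lebesgue_stieltjes_measure g U).
  rewrite -UeE; apply: nondecreasing_cvg_mu => //; first by rewrite UeE.
  move=> n m nm; apply/subsetPset; rewrite /E -!bigcup_mkord.
  by apply: bigcup_sub => k /= kn x Jx; exists k => //=; exact: leq_trans kn _.
have MUe : (`|M1 U - M2 U| <= e%:E)%E.
  have cv : `|M1 (E n) - M2 (E n)|%E @[n --> \oo] --> `|M1 U - M2 U|%E.
    apply: cvg_abse; apply: cvgeB; [|exact: cvgE|exact: cvgE].
    by apply: fin_num_adde_defr; exact: Lfin.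
  by rewrite -(cvg_lim _ cv)//; apply: lime_le; [exact: cvgP cv|exact: nearW].
have DU : D `<=` `]a, b] by apply: subset_trans Uab; exact: subDsetl.
have M1U : (M1 U = M1 D + M1 A)%E := UE h1.
have M2U : (M2 U = M2 D + M2 A)%E := UE h2.
have M1D0 : (0 <= M1 D)%E by exact: measure_ge0.
have M2D0 : (0 <= M2 D)%E by exact: measure_ge0.
have M1A : M1 A \is a fin_num := Lfin h1 _ mA Aab.
have M2A : M2 A \is a fin_num := Lfin h2 _ mA Aab.
have M1Df : M1 D \is a fin_num := Lfin h1 _ mD DU.
have M2Df : M2 D \is a fin_num := Lfin h2 _ mD DU.
have {}M1D : (M1 D < eps%:E)%E := M1D.
have {}M2D : (M2 D < eps%:E)%E := M2D.
rewrite M1U M2U in MUe.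
move: M1A M2A M1Df M2Df M1D M2D M1D0 M2D0 MUe {M1U M2U}.
move: (M1 A) (M2 A) (M1 D) (M2 D) => [x| |] [y| |] [t| |] [w| |]// _ _ _ _.
rewrite -!EFinD -?EFinB !lee_fin !lte_fin /eps !lt_min.
move=> /andP[te _] /andP[we _] t0 w0; rewrite ler_norml => /andP[l1 l2].
by rewrite ler_norml; apply/andP; split; lra.
Qed.

End null_sets.

(** * Reflection x |-> -x, from right-continuous to left-continuous integrators *)

Section reflection.
Context {R : realType}.

Lemma lebesgue_measure_opp (A : set R) : measurable A ->
  lebesgue_measure (-%R @^-1` A) = lebesgue_measure A.
Proof.
move=> mA; have mN : measurable_fun [set: measurableTypeR R] 
    (-%R : measurableTypeR R -> measurableTypeR R).
  exact: measurable_realfun.oppr_measurable.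
pose N : {measure set (measurableTypeR R) -> \bar R} :=
  measure_function_pushforward__canonical__measure_function_Measure
    lebesgue_measure mN.
apply/esym; apply: (lebesgue_measure_unique (mu := N)) => // _ [[a b] _ <-]/=.
rewrite /pushforward; have -> : -%R @^-1` `]a, b]%classic = `[- b, - a[%classic :> set R.
  apply/seteqP; split => x; rewrite /= !in_itv/=.
    by move=> /andP[ax xb]; rewrite lerNl xb ltrNr.
  by move=> /andP[bx xa]; rewrite ltrNr xa lerNl.
by rewrite !lebesgue_measure_itv/= !lte_fin ltrN2 -!EFinD opprK addrC.
Qed.

Lemma abs_continuous_itv_reflect (f : R -> R) (a b : R) :
  abs_continuous_itv f (- b) (- a) ->
  abs_continuous_itv (fun x => - f (- x)) a b.
Proof.
move=> ac e e0; have [r r0 acr] := ac _ e0; exists r => // n u v uv tuv small.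
have -> : \sum_(i < n) `|- f (- v i) - - f (- u i)| =
    \sum_(i < n) `|f (- u i) - f (- v i)|.
  by apply: eq_bigr => i _; congr (`|_|); ring.
apply: (acr n (fun i => - v i) (fun i => - u i)).
- by move=> i /uv[? []]; rewrite !lerN2.
- apply/trivIsetP => i j ni nj ij; move/trivIsetP : tuv => /(_ i j ni nj ij).
  rewrite -!subset0 => IJ x [] /=; rewrite !in_itv/=.
  move=> /andP[vx xu] /andP[vx' xu']; apply: (IJ (- x)).
  by rewrite /= !in_itv/=; split; apply/andP; split; lra.
- apply: le_lt_trans small; rewrite le_eqVlt; apply/orP; left; apply/eqP.
  by apply: eq_bigr => i _; ring.
Qed.

End reflection.

Section lc_null_sets.
Context {R : realType} {b1 b2 : R -> R}.
Variables (nd1 : nondecreasing_fun b1) (lc1 : left_continuous b1)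
  (nd2 : nondecreasing_fun b2) (lc2 : left_continuous b2).

(** The measures are pushforwards under reflection, so the previous result applies to -A inside ]-c,
    -a], which is null by the symmetry of Lebesgue measure. *)
Lemma lc_stieltjes_null (a c : R) (A : set R) : a <= c ->
  abs_continuous_itv (fun x => b1 x - b2 x) a c ->
  measurable A -> A `<=` `[a, c[ -> lebesgue_measure A = 0%E ->
  lc_stieltjes nd1 lc1 A = lc_stieltjes nd2 lc2 A.
Proof.
move=> ac abc mA Aac A0.
apply: (@stieltjes_abs_continuous_null _ (lc_reflect nd1 lc1)
  (lc_reflect nd2 lc2) (- c) (- a)).
- by rewrite lerN2.
- have := @abs_continuous_itv_reflect R (fun x => b1 x - b2 x) (- c) (- a).
  rewrite !opprK => /(_ abc) e; move=> eps /e[r r0 rP]; exists r => // n u v uv tuv small.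
  have := rP n u v uv tuv small; congr (_ < _); apply: eq_bigr => i _.
  by rewrite /= /lc_reflect; congr (`|_|); ring.
- by rewrite -[X in measurable X]setTI; exact: oppr_measurable.
- move=> x /= /Aac; rewrite /= !in_itv/= => /andP[ax xc].
  by rewrite ltrNl xc lerNr.
- by rewrite lebesgue_measure_opp.
Qed.

End lc_null_sets.

(** * Radon-Nikodym density on a bounded interval *)

Section borel_copy.
Context {R : realType}.
Variable m : {measure set R -> \bar R}.

(* [R] and [measurableTypeR R] have the same measurable sets but distinct
   displays; the Lebesgue measure lives on the latter. *)
Definition borel_copy : set (measurableTypeR R) -> \bar R := m.

Let borel_copy0 : borel_copy set0 = 0%E. Proof. exact: measure0. Qed.

Let borel_copy_ge0 A : (0 <= borel_copy A)%E. Proof. exact: measure_ge0. Qed.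

Let borel_copy_sigma_additive : semi_sigma_additive borel_copy.
Proof. exact: (@measure_semi_sigma_additive _ _ _ m). Qed.

HB.instance Definition _ := isMeasure.Build _ _ _ borel_copy
  borel_copy0 borel_copy_ge0 borel_copy_sigma_additive.

End borel_copy.

Section density.
Context {R : realType} {b1 b2 : R -> R}.
Variables (nd1 : nondecreasing_fun b1) (lc1 : left_continuous b1)
  (nd2 : nondecreasing_fun b2) (lc2 : left_continuous b2).
Let b x := b1 x - b2 x.

(** Restricting to [a, c[ makes both measures finite, so that their difference is a charge.
    Agreement on null sets gives domination by Lebesgue measure, and the primitive of the density is
    differentiable almost everywhere. *)
Lemma abs_continuous_density (a c : R) : a <= c -> abs_continuous_itv b a c ->
  exists f : R -> R, [/\ lebesgue_measure.-integrable setT (EFin \o f),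
    (forall A, measurable A -> A `<=` `[a, c[ ->
      lc_stieltjes nd1 lc1 A =
      lc_stieltjes nd2 lc2 A + \int[lebesgue_measure]_(x in A) (f x)%:E)%E &
    {ae lebesgue_measure, forall x, x \in `]a, c[ ->
      derivable b x 1 /\ b^`()%classic x = f x}].
Proof.
move=> ac abc.
pose D : set R := `[a, c[%classic.
have mD : measurable (D : set (measurableTypeR R)) := measurable_itv _.
pose m1 := borel_copy (lc_stieltjes nd1 lc1).
pose m2 := borel_copy (lc_stieltjes nd2 lc2).
have fin1 : (m1 D < +oo)%E by rewrite [m1 D]lc_stieltjes_itv// ltry.
have fin2 : (m2 D < +oo)%E by rewrite [m2 D]lc_stieltjes_itv// ltry.
pose nu : {charge set (measurableTypeR R) -> \bar R} :=
  cadd (charge_of_finite_measure (mfrestr mD fin1))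
       (copp (charge_of_finite_measure (mfrestr mD fin2))).
have nuE A : (nu A = lc_stieltjes nd1 lc1 (A `&` D) - lc_stieltjes nd2 lc2 (A `&` D))%E.
  by [].
have sfin g (nd : nondecreasing_fun g) (lc : left_continuous g) A :
    measurable A -> A `<=` D -> lc_stieltjes nd lc A \is a fin_num.
  move=> mA AD; rewrite ge0_fin_numE//.
  apply: (@le_lt_trans _ _ (lc_stieltjes nd lc D)).
    by apply: le_measure; rewrite ?inE.
  by rewrite lc_stieltjes_itv// ltry.
have nudom : nu `<< lebesgue_measure.
  apply/null_content_dominatesP => A mA A0; rewrite nuE.
  rewrite (@lc_stieltjes_null _ _ _ nd1 lc1 nd2 lc2 a c)//.
  - by rewrite subee// sfin//; exact: measurableI.
  - exact: measurableI.
  - apply/eqP; rewrite eq_le measure_ge0 andbT -A0.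
    by apply: le_measure; rewrite ?inE//; exact: measurableI.
pose f := fine \o Radon_Nikodym nu lebesgue_measure.
have fE : EFin \o f = Radon_Nikodym nu lebesgue_measure.
  by apply/funext => x /=; rewrite fineK//; exact: Radon_Nikodym_fin_num.
have intf : lebesgue_measure.-integrable setT (EFin \o f).
  by rewrite fE; exact: Radon_Nikodym_integrable.
have nuf A : measurable A -> (nu A = \int[lebesgue_measure]_(x in A) (f x)%:E)%E.
  move=> mA; rewrite (Radon_Nikodym_integral nudom)//.
  by apply: eq_integral => x _; rewrite -fE.
(* The charge lives on [a, c[, so integrating from -oo amounts to integrating from a. Dropping the
   null point x gives the interval [a, x[ on which the Stieltjes measures are explicit. *)
have FE x : x \in `[a, c] ->
    \int[lebesgue_measure]_(t in `]-oo, x]) f t = b x - b a.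
  rewrite in_itv/= => /andP[ax xc].
  rewrite -Rintegral_itv_bndo_bndc; last exact: integrableS intf.
  rewrite /Rintegral -nuf// nuE.
  have -> : `]-oo, x[%classic `&` D = `[a, x[%classic.
    apply/seteqP; split=> y; rewrite /D/= !in_itv/=.
      by move=> [-> /andP[-> _]].
    by move=> /andP[-> yx]; rewrite yx (lt_le_trans yx xc).
  by rewrite !lc_stieltjes_itv//= /b; ring.
exists f; split; first exact: intf.
- move=> A mA AD; have AE : A `&` D = A by exact/setIidl.
  have := nuf A mA; rewrite nuE AE => <-.
  by rewrite addeC subeK// sfin.
- have locf : locally_integrable [set: R] f.
    by apply: open_integrable_locally; [exact: openT|exact: intf].
  have intfy y : lebesgue_measure.-integrable `]-oo, y] (EFin \o f).
    exact: integrableS intf.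
  have := FTC1Ny intfy locf.
  apply: filterS; first exact: (ae_filter_ringOfSetsType (@lebesgue_measure R)).
  move=> x [].
  set F := fun x => _; move=> dF F' xac.
  (* Near an interior point F and b differ by the constant b a, so the derivative of F passes to
     b. *)
  have nearF : \forall y \near x, F y = b y - b a.
    have : open_nbhs x `]a, c[%classic by split=> //; exact: interval_open.
    move=> /open_nbhs_nbhs; apply: filterS => y /= yac; apply: FE.
    exact: subset_itv_oo_cc yac.
  have nearb : \forall y \near x, F y + b a = b y.
    by apply: filterS nearF => y ->; rewrite subrK.
  have dFa : is_derive x 1 (fun y => F y + b a) (f x).
    rewrite -[f x]addr0 -F' derive1E.
    by apply: is_deriveD; exact: DeriveDef.
  have := near_eq_is_derive nearb dFa => -[db Db].
  by split=> //; rewrite derive1E.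
Qed.

End density.

(** * Integrals of functions known only off a null set *)

Section integral_off_null_set.
Context {d} {T : measurableType d} {R : realType}.
Variable m : {measure set T -> \bar R}.
Local Open Scope ereal_scope.

(** Enlarging the function only adds competitors to the supremum over simple functions below it. *)
Lemma ge0_le_integral_nonmeasurable (f g : T -> \bar R) :
  (forall x, 0 <= f x) -> (forall x, f x <= g x) ->
  \int[m]_x f x <= \int[m]_x g x.
Proof.
move=> f0 fg; have g0 x : 0 <= g x by exact: le_trans (f0 x) (fg x).
rewrite !ge0_integralTE//; apply: ereal_sup_le => _ [h /= hf <-].
by exists h => //= x; exact: le_trans (hf x) (fg x).
Qed.

(** [f] is squeezed between [g] set to 0 on [N] and [g] set to +oo on [N]; both are measurable and
    almost everywhere equal to [g]. *)
Let ge0_integral_off_null (N : set T) (f g : T -> \bar R) :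
  measurable N -> m N = 0 -> measurable_fun setT g ->
  (forall x, 0 <= f x) -> (forall x, 0 <= g x) ->
  (forall x, ~ N x -> f x = g x) -> \int[m]_x f x = \int[m]_x g x.
Proof.
move=> mN N0 mg f0 g0 fg.
have ae_g (h : T -> \bar R) : measurable_fun setT h -> (forall x, 0 <= h x) ->
    (forall x, ~ N x -> h x = g x) -> \int[m]_x h x = \int[m]_x g x.
  move=> mh h0 hg; apply: ge0_ae_eq_integral => //.
  exists N; split => // x /= /not_implyP[_ hgx].
  by apply: contrapT => /hg.
have mCN : measurable (~` N) by exact: measurableC.
apply/eqP; rewrite eq_le; apply/andP; split.
- rewrite -(ae_g (fun x => if x \in N then +oo else g x)).
  + apply: ge0_le_integral_nonmeasurable => // x.
    by case: ifPn => [_|/negP]; rewrite ?leey// inE => /fg ->.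
  + apply: measurable_fun_ifT => //.
    by apply: (measurable_fun_bool true) => //; rewrite setTI preimage_mem_true.
  + by move=> x; case: ifP.
  + by move=> x Nx; rewrite memNset.
- rewrite -(ae_g (g \_ (~` N))).
  + apply: ge0_le_integral_nonmeasurable => x; rewrite patchE; case: ifPn => //.
    by rewrite inE => /fg ->.
  + by apply/(measurable_restrictT _ _).1 => //; exact: measurable_funTS.
  + by move=> x; rewrite patchE; case: ifP.
  + by move=> x Nx; rewrite patchE mem_set.
Qed.

(* [f] need not be measurable, because [integral] is defined by suprema over
   simple functions; this applies to [f] involving [b^`()]. *)
Lemma integral_off_null_nonmeasurable (N : set T) (f g : T -> \bar R) :
  measurable N -> m N = 0 -> measurable_fun setT g ->
  (forall x, ~ N x -> f x = g x) -> \int[m]_x f x = \int[m]_x g x.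
Proof.
move=> mN N0 mg fg; rewrite integralE [RHS]integralE; congr (_ - _).
- apply: (ge0_integral_off_null mN) => //; first exact: measurable_funepos.
  by move=> x /fg fgx; rewrite !funeposE fgx.
- apply: (ge0_integral_off_null mN) => //; first exact: measurable_funeneg.
  by move=> x /fg fgx; rewrite !funenegE fgx.
Qed.

End integral_off_null_set.

(** * A measurable version of the derivative *)

Section right_difference_quotient.
Context {R : realType}.
Variable b : R -> R.

(* A Borel representative of the derivative; the limsup avoids proving that the
   set where [b] is derivable is Borel. *)
Definition right_quotient_limit (x : R) : R :=
  fine (limn_esup (fun n => (n.+1%:R * (b (x + n.+1%:R^-1) - b x))%:E)).

Lemma measurable_right_quotient_limit :
  measurable_fun [set: R] b -> measurable_fun [set: R] right_quotient_limit.
Proof.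
move=> mb; apply: measurableT_comp => //.
apply: measurable_fun_limn_esup => n; apply/measurable_EFinP.
apply: measurable_funM => //; apply: measurable_funB => //.
apply: measurableT_comp => //; exact: measurable_funD.
Qed.

Lemma right_quotient_limitE x :
  derivable b x 1 -> b^`()%classic x = right_quotient_limit x.
Proof.
move=> dbx.
have cvgb : h^-1 *: (b (h + x) - b x) @[h --> 0^'] --> b^`()%classic x.
  rewrite derive1E; move: dbx; rewrite /derivable /derive.
  under [in X in cvg X -> _]eq_fun do rewrite /= [_%:A]mulr1.
  by under [in X in _ -> _ --> X]eq_fun do rewrite /= [_%:A]mulr1.
have {}cvgb : (n.+1%:R * (b (x + n.+1%:R^-1) - b x))%:E @[n --> \oo] -->
    (b^`()%classic x)%:E.
  apply/cvg_EFin; first exact: nearW.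
  rewrite [X in X @ _](_ : _ = (fun n : nat =>
      (n.+1%:R^-1)^-1 *: (b (n.+1%:R^-1 + x) - b x))); last first.
    by apply/funext => n; rewrite /= invrK [_ + x]addrC.
  (* The increments 1/(n+1) are nonzero and tend to 0, as the punctured limit requires. *)
  apply: ((cvgr_dnbhsP _ _ _).1 cvgb (fun n => n.+1%:R^-1)).
  by split; [move=> n; rewrite invr_eq0|exact: cvg_harmonic].
rewrite /right_quotient_limit is_cvg_limn_esupE; last exact: cvgP cvgb.
by rewrite (cvg_lim _ cvgb).
Qed.

End right_difference_quotient.

(** * One density for the whole line *)

Section global_density.
Context {R : realType} {b1 b2 : R -> R}.
Variables (nd1 : nondecreasing_fun b1) (lc1 : left_continuous b1)
  (nd2 : nondecreasing_fun b2) (lc2 : left_continuous b2).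
Let b x := b1 x - b2 x.
Let L : {measure set (measurableTypeR R) -> \bar R} := lebesgue_measure.

(** Split by the sign of [f]: where f >= 0 its integral is at most the db1-measure, elsewhere that
    of -f is at most the db2-measure. This makes b1 + b2 the function [B] of the kernel identity. *)
Let density_bound (a c : R) (f : R -> R) : a <= c ->
  L.-integrable `[a, c[ (EFin \o f) ->
  (forall A, measurable A -> A `<=` `[a, c[ ->
    lc_stieltjes nd1 lc1 A =
    lc_stieltjes nd2 lc2 A + \int[lebesgue_measure]_(x in A) (f x)%:E)%E ->
  (\int[L]_(x in `[a, c[) `|f x|%:E <=
    ((b1 c + b2 c) - (b1 a + b2 a))%:E)%E.
Proof.
move=> ac iacf fE.
pose S : set R := `[a, c[%classic.
have mS : measurable (S : set (measurableTypeR R)) by exact: measurable_itv.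
have mf : measurable_fun (S : set (measurableTypeR R)) f.
  by apply/measurable_EFinP; exact: measurable_int iacf.
pose Sp := S `&` [set x | 0 <= f x].
have mSp : measurable (Sp : set (measurableTypeR R)).
  by apply: measurable_fun_le => //; exact: measurable_cst.
pose Sn := S `\` Sp.
have mSn : measurable (Sn : set (measurableTypeR R)) by exact: measurableD.
have SpS : Sp `<=` S by exact: subIsetl.
have SnS : Sn `<=` S by exact: subDsetl.
have SE : Sp `|` Sn = S by exact: setDUK.
have SpSn : [disjoint Sp & Sn].
  by apply/disj_setPS => x [Spx [_ /(_ Spx)]].
have ip : L.-integrable Sp (EFin \o f) by exact: integrableS iacf.
have iq : L.-integrable Sn (EFin \o f) by exact: integrableS iacf.
have absp : (\int[L]_(x in Sp) `|f x|%:E = \int[L]_(x in Sp) (f x)%:E)%E.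
  apply: eq_integral => x; rewrite inE => -[_ /= f0].
  by rewrite ger0_norm.
have absn : (\int[L]_(x in Sn) `|f x|%:E = - \int[L]_(x in Sn) (f x)%:E)%E.
  rewrite -integralN; last exact: integrable_add_def.
  apply: eq_integral => x; rewrite inE => -[Sx Spx].
  rewrite -EFinN; congr EFin; apply: ltr0_norm.
  by rewrite ltNge; apply/negP => fx; exact: Spx.
have addS (m : {measure set R -> \bar R}) : (m S = m Sp + m Sn)%E.
  by rewrite -measureU// ?SE//; exact/eqP/SpSn.
have S1E : (lc_stieltjes nd1 lc1 Sp + lc_stieltjes nd1 lc1 Sn = (b1 c - b1 a)%:E)%E.
  by rewrite -(lc_stieltjes_itv nd1 lc1 ac) -/S (addS (lc_stieltjes nd1 lc1)).
have S2E : (lc_stieltjes nd2 lc2 Sp + lc_stieltjes nd2 lc2 Sn = (b2 c - b2 a)%:E)%E.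
  by rewrite -(lc_stieltjes_itv nd2 lc2 ac) -/S (addS (lc_stieltjes nd2 lc2)).
have x0 : (0 <= lc_stieltjes nd1 lc1 Sp)%E by exact: measure_ge0.
have y0 : (0 <= lc_stieltjes nd1 lc1 Sn)%E by exact: measure_ge0.
have x'0 : (0 <= lc_stieltjes nd2 lc2 Sp)%E by exact: measure_ge0.
have y'0 : (0 <= lc_stieltjes nd2 lc2 Sn)%E by exact: measure_ge0.
rewrite -[X in (X <= _)%E](_ : (\int[L]_(x in Sp `|` Sn) `|f x|%:E)%E = _); last first.
  by rewrite SE.
rewrite ge0_integral_setU//=; last first.
  by rewrite SE; apply/measurable_EFinP; exact: measurableT_comp.
rewrite absp absn.
have := fE _ mSp SpS; have := fE _ mSn SnS; rewrite -/L.
have := integrable_fin_num mSp ip; have := integrable_fin_num mSn iq.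
move: x0 y0 x'0 y'0 S1E S2E.
move: (lc_stieltjes nd1 lc1 Sp) (lc_stieltjes nd1 lc1 Sn)
  (lc_stieltjes nd2 lc2 Sp) (lc_stieltjes nd2 lc2 Sn) => x y x' y'.
move: (\int[L]_(x in Sp) _)%E (\int[L]_(x in Sn) _)%E => p q.
move: x y x' y' p q => [x| |] [y| |] [x'| |] [y'| |] [p| |] [q| |]//.
rewrite !lee_fin => x0 y0 x'0 y'0 [S1E] [S2E] _ _ [yE] [xE].
by lra.
Qed.

(** The densities [fn n] belong to different intervals [-n, n[, but off one common null set each
    equals the derivative of [b] inside its interval. A single measurable version of the derivative
    can thus replace them all. *)
Lemma abs_continuous_derive1 : abs_continuous b -> exists f : R -> R,
  [/\ measurable_fun [set: R] f,
    exists N, [/\ measurable N, lebesgue_measure N = 0%E &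
      forall x, ~ N x -> b^`()%classic x = f x] &
    forall x y, x <= y -> [/\ L.-integrable `[x, y[ (EFin \o f),
      (\int[L]_(t in `[x, y[) (f t)%:E = (b y - b x)%:E)%E &
      (\int[L]_(t in `[x, y[) `|f t|%:E <=
        ((b1 y + b2 y) - (b1 x + b2 x))%:E)%E]].
Proof.
move=> ac; have mb : measurable_fun [set: R] b.
  by apply: measurable_funB; exact: nondecreasing_measurable.
have nn n : - n%:R <= n%:R :> R by rewrite ge0_cp.
have /choice[fn fnP] n := abs_continuous_density nd1 lc1 nd2 lc2 (nn n) (ac _ _).
pose f := right_quotient_limit b.
have mf : measurable_fun [set: R] f by exact: measurable_right_quotient_limit.
pose bad n := ~` [set x | x \in `]- n%:R, n%:R[ ->
  derivable b x 1 /\ b^`()%classic x = fn n x].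
have bad0 n : L.-negligible (bad n) by have [_ _] := fnP n.
have /negligible_bigcup [N [mN N0 badN]] := bad0.
have good x n : ~ N x -> x \in `]- n%:R, n%:R[ ->
    derivable b x 1 /\ b^`()%classic x = fn n x.
  move=> Nx xn; apply: contrapT => notgood; apply: Nx; apply: badN.
  by exists n => // /(_ xn).
have bound (x : R) : exists n, x \in `]- n%:R, n%:R[.
  exists (Num.truncn `|x|).+1.
  by rewrite in_itv/= -ltr_norml truncnS_gt.
have bf x : ~ N x -> b^`()%classic x = f x.
  move=> Nx; have [n xn] := bound x; have [dbx _] := good x n Nx xn.
  exact: right_quotient_limitE.
have ffn n x : ~ N x -> x \in `]- n%:R, n%:R[ -> f x = fn n x.
  by move=> Nx xn; rewrite -bf//; have [] := good x n Nx xn.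
exists f; split => //; first by exists N.
move=> x y xy.
(* This n puts [x, y[ inside the open interval ]-n, n[, where [f] and [fn n] agree off [N]. *)
pose n := (Num.truncn (`|x| + `|y|)).+1.
have xyn : `|x| + `|y| < n%:R by exact: truncnS_gt.
have nx : - n%:R < x by have := ler_norm (- x); rewrite normrN; have := normr_ge0 y; lra.
have yn : y < n%:R by have := ler_norm y; have := normr_ge0 x; lra.
pose S : set R := `[x, y[%classic.
have mS : measurable (S : set (measurableTypeR R)) by exact: measurable_itv.
have Sn : S `<=` `[- n%:R, n%:R[.
  by apply: subset_itv; rewrite bnd_simp ltW.
have ae_f : ae_eq L S (EFin \o f) (EFin \o fn n).
  exists N; split => // t /= /not_implyP[St ft].
  apply: contrapT => Nt; apply: ft; rewrite (ffn n)// in_itv/=.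
  move: St; rewrite /S /= in_itv/= => /andP[xt ty].
  by rewrite (lt_le_trans nx xt) (lt_trans ty yn).
have [ifn fnE _] := fnP n.
have ifnS : L.-integrable S (EFin \o fn n) by exact: integrableS ifn.
have mfS : measurable_fun (S : set (measurableTypeR R)) f by exact: measurable_funS mf.
have mfnS : measurable_fun (S : set (measurableTypeR R)) (fn n).
  by apply/measurable_EFinP; exact: measurable_int ifnS.
have absE : (\int[L]_(t in S) `|f t|%:E = \int[L]_(t in S) `|fn n t|%:E)%E.
  apply: ae_eq_integral => //.
  - by apply/measurable_EFinP; exact: measurableT_comp.
  - by apply/measurable_EFinP; exact: measurableT_comp.
  - by apply: filterS ae_f => t /[apply] -[->].
have fE : (\int[L]_(t in S) (f t)%:E = \int[L]_(t in S) (fn n t)%:E)%E.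
  by apply: ae_eq_integral => //; exact/measurable_EFinP.
split.
- apply/integrableP; split; first exact/measurable_EFinP.
  by rewrite absE; have /integrableP[] := ifnS.
- rewrite -/S fE; have := fnE _ mS Sn; rewrite -/L.
  rewrite [lc_stieltjes nd1 lc1 S]lc_stieltjes_itv//.
  rewrite [lc_stieltjes nd2 lc2 S]lc_stieltjes_itv//.
  have := integrable_fin_num mS ifnS.
  move: (\int[L]_(t in S) (fn n t)%:E)%E => [p| |]// _ [pE].
  by congr EFin; rewrite /b; lra.
- rewrite -/S absE; apply: (density_bound xy ifnS) => A mA AS.
  by apply: fnE => //; exact: subset_trans Sn.
Qed.

End global_density.

(** * Lebesgue measure in the form used by the kernel identity *)

Section real_lebesgue.
Context {R : realType}.

(* The Lebesgue measure on [R] itself rather than on [measurableTypeR R]. *)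
Definition real_lebesgue : set R -> \bar R :=
  pushforward lebesgue_measure (idfun : measurableTypeR R -> R).

Let real_lebesgue0 : real_lebesgue set0 = 0%E.
Proof. exact: (measure0 (@lebesgue_measure R)). Qed.

Let real_lebesgue_ge0 A : (0 <= real_lebesgue A)%E.
Proof. exact: (measure_ge0 (@lebesgue_measure R)). Qed.

Let real_lebesgue_sigma_additive : semi_sigma_additive real_lebesgue.
Proof.
exact: (@measure_semi_sigma_additive _ _ _ (@lebesgue_measure R)).
Qed.

HB.instance Definition _ := isMeasure.Build _ _ _ real_lebesgue
  real_lebesgue0 real_lebesgue_ge0 real_lebesgue_sigma_additive.

Let real_lebesgue_sigma_finite : sigma_finite setT real_lebesgue.
Proof. exact: (sigma_finiteT (@lebesgue_measure R)). Qed.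

HB.instance Definition _ := @Measure_isSigmaFinite.Build _ _ _ real_lebesgue
  real_lebesgue_sigma_finite.

Lemma integral_real_lebesgue (D : set R) (f : R -> \bar R) : measurable D ->
  measurable_fun D f ->
  (\int[real_lebesgue]_(x in D) f x = \int[lebesgue_measure]_(x in D) f x)%E.
Proof.
move=> mD mf; rewrite integralE [RHS]integralE.
have mid : measurable_fun [set: measurableTypeR R] (idfun : measurableTypeR R -> R).
  exact: measurable_id.
have H (h : R -> \bar R) : measurable_fun D h -> (forall x, 0 <= h x)%E ->
    (\int[real_lebesgue]_(x in D) h x = \int[lebesgue_measure]_(x in D) h x)%E.
  move=> mh h0.
  exact: (@ge0_integral_pushforward _ _ _ _ _ (idfun : measurableTypeR R -> R)
    mid lebesgue_measure D h mD mh (fun x _ => h0 x)).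
by congr (_ - _)%E; apply: H => //; [exact: measurable_funepos|exact: measurable_funeneg].
Qed.

Lemma integrable_real_lebesgue (D : set R) (f : R -> \bar R) : measurable D ->
  lebesgue_measure.-integrable D f -> real_lebesgue.-integrable D f.
Proof.
move=> mD /integrableP[mf foo]; apply/integrableP; split => //.
rewrite integral_real_lebesgue//; exact: measurableT_comp.
Qed.

End real_lebesgue.

(** * The kernel identity for Stieltjes measures and for the derivative *)

Section stieltjes_kernel_integral.
Context {d} {T : measurableType d} {R : realType} {P : probability T R}.
Variables (X : {RV P >-> R}) (z : R).
Local Open Scope ereal_scope.
Let mu : probability R R := distribution P X.

(** The density is the constant 1, and the monotone [g] serves both as primitive and as its own
    bound [B]. *)
Lemma integral_cov_kernel_lc_stieltjes {g : R -> R}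
    (nd : nondecreasing_fun g) (lc : left_continuous g) :
  mu.-integrable setT (EFin \o g) ->
  \int[lc_stieltjes nd lc]_y cov_kernel X z y =
  cdf X z * \int[mu]_x (g x)%:E - \int[mu]_(x in `]-oo, z]) (g x)%:E.
Proof.
move=> ig; rewrite -(@integral_cov_kernel _ _ _ _ X z
  (lc_stieltjes nd lc) (cst 1%R) g g)//.
- by apply: eq_integral => y _; rewrite mule1.
- move=> x y xy; split.
    apply/integrableP; split; first by apply/measurable_EFinP; exact: measurable_cst.
    rewrite (eq_integral (cst 1)) => [|t _]; last by rewrite /= normr1.
    by rewrite integral_cst// mul1e [ltLHS]lc_stieltjes_itv// ltry.
  rewrite (eq_integral (cst 1)) => [|t _//].
  by rewrite integral_cst// mul1e [LHS]lc_stieltjes_itv.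
- move=> x y xy; rewrite (eq_integral (cst 1)) => [|t _]; last by rewrite /= normr1.
  by rewrite integral_cst// mul1e [leLHS]lc_stieltjes_itv.
Qed.

Lemma integral_cov_kernel_derive1 {b1 b2 : R -> R}
    (nd1 : nondecreasing_fun b1) (lc1 : left_continuous b1)
    (nd2 : nondecreasing_fun b2) (lc2 : left_continuous b2)
    (b := fun x => (b1 x - b2 x)%R) :
  mu.-integrable setT (EFin \o b1) -> mu.-integrable setT (EFin \o b2) ->
  abs_continuous b ->
  \int[lebesgue_measure]_y (cov_kernel X z y * (b^`()%classic y)%:E) =
  cdf X z * \int[mu]_x (b x)%:E - \int[mu]_(x in `]-oo, z]) (b x)%:E.
Proof.
move=> ib1 ib2 ac.
have [f [mf [N [mN N0 bf]] fE]] := abs_continuous_derive1 nd1 lc1 nd2 lc2 ac.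
have mK : measurable_fun [set: R] (fun y => cov_kernel X z y * (f y)%:E).
  apply: emeasurable_funM; last exact/measurable_EFinP.
  apply: emeasurable_funB.
    apply: (measurableT_comp (@cdf_measurable _ _ _ _ X)).
    exact: measurable_minr.
  by apply: measurable_funeM; exact: cdf_measurable.
(* The derivative is exchanged for its measurable version [f] before Fubini's theorem is applied. *)
rewrite (@integral_off_null_nonmeasurable _ _ _ lebesgue_measure N _
  (fun y => cov_kernel X z y * (f y)%:E))//; last first.
  by move=> y /bf ->.
rewrite -integral_real_lebesgue//.
apply: (@integral_cov_kernel _ _ _ _ X z real_lebesgue f b (b1 \+ b2)%R) => //.
- exact: (@integrableB _ _ _ mu setT measurableT _ _ ib1 ib2).
- exact: (@integrableD _ _ _ mu setT measurableT _ _ ib1 ib2).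
- move=> x y /fE[ifx fxy _]; split; first exact: integrable_real_lebesgue.
  rewrite integral_real_lebesgue//.
  by apply/measurable_EFinP; exact: measurable_funS mf.
- move=> x y /fE[_ _ fxy]; rewrite integral_real_lebesgue//.
  apply/measurable_EFinP; apply: measurableT_comp => //.
  exact: measurable_funS mf.
Qed.

End stieltjes_kernel_integral.

(** * Assembly of the covariance identities *)

Theorem corollary2p3 (d : measure_display) (T : measurableType d)
    (R : realType) (P : probability T R) (X : {RV P >-> R}) (z : R)
    (b b1 b2 : R -> R)
    (nd1 : nondecreasing_fun b1) (lc1 : left_continuous b1)
    (nd2 : nondecreasing_fun b2) (lc2 : left_continuous b2) :
  let mu : probability R R := distribution P X in
  let F := cdf X in
  (forall x, b x = b1 x - b2 x) ->
  (b1 \in Lfun mu 2%:E /\ b2 \in Lfun mu 2%:E) \/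
  (b1 \in Lfun mu 1%:E /\ b2 \in Lfun mu 1%:E) ->
  (((F z * \int[mu]_x (b x)%:E - \int[mu]_(x in `]-oo, z]) (b x)%:E
      = - covariance P \1_[set t | (X t <= z)%R] (b \o X)) /\
    (- covariance P \1_[set t | (X t <= z)%R] (b \o X)
      = int_dB (cov_kernel X z) nd1 lc1 nd2 lc2)) /\
   ((- (1 - F z) * \int[mu]_x (b x)%:E + \int[mu]_(x in `]z, +oo[) (b x)%:E
      = covariance P \1_[set t | (X t > z)%R] (b \o X)) /\
    (covariance P \1_[set t | (X t > z)%R] (b \o X)
      = int_dB (cov_kernel X z) nd1 lc1 nd2 lc2)))%E /\
  (b \in Lfun mu 1%:E -> abs_continuous b ->
   ((F z * \int[mu]_x (b x)%:E - \int[mu]_(x in `]-oo, z]) (b x)%:E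
      = - covariance P \1_[set t | (X t <= z)%R] (b \o X)) /\
    (- covariance P \1_[set t | (X t <= z)%R] (b \o X)
      = \int[lebesgue_measure]_y (cov_kernel X z y * (b^`()%classic y)%:E))) /\
   ((- (1 - F z) * \int[mu]_x (b x)%:E + \int[mu]_(x in `]z, +oo[) (b x)%:E
      = covariance P \1_[set t | (X t > z)%R] (b \o X)) /\
    (covariance P \1_[set t | (X t > z)%R] (b \o X)
      = \int[lebesgue_measure]_y (cov_kernel X z y * (b^`()%classic y)%:E))))%E.
Proof.
move=> mu F bE bL.
(* Since [mu] is finite, L2 lies in L1, and both alternatives reduce to integrable b1 and b2. *)
have L21 : {subset Lfun mu 2%:E <= Lfun mu 1%:E}.
  by apply: Lfun_subset12; rewrite fin_num_measure.
have [ib1 ib2] : mu.-integrable setT (EFin \o b1) /\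
    mu.-integrable setT (EFin \o b2).
  by case: bL => -[b1L b2L]; split; apply/Lfun1_integrable => //; exact: L21.
have {bE} bE : b = (fun x => b1 x - b2 x) by exact/funext.
rewrite bE.
have ib : mu.-integrable setT (EFin \o (fun x => b1 x - b2 x)).
  exact: (@integrableB _ _ _ mu setT measurableT _ _ ib1 ib2).
have cov_le := covariance_indic_le ib z.
have cov_gt := covariance_indic_gt ib z.
have cov_gtN := covariance_indic_gtN ib z.
split.
(* The identities for b1 and b2 are subtracted; all terms are finite, so the extended-real
   arithmetic reduces to that of real numbers. *)
- have dBE : int_dB (cov_kernel X z) nd1 lc1 nd2 lc2 =
    (- covariance P \1_[set t | (X t <= z)%R] ((fun x => (b1 x - b2 x)%R) \o X))%E.
    rewrite -cov_le /int_dB !integral_cov_kernel_lc_stieltjes// -/mu.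
    have Ffin : cdf X z \is a fin_num by rewrite fin_num_measure.
    have ib1z : mu.-integrable `]-oo, z]%classic (EFin \o b1) by exact: integrableS ib1.
    have ib2z : mu.-integrable `]-oo, z]%classic (EFin \o b2) by exact: integrableS ib2.
    rewrite (integralB measurableT ib1 ib2).
    rewrite (integralB (measurable_itv _) ib1z ib2z) /=.
    have := integrable_fin_num measurableT ib1.
    have := integrable_fin_num measurableT ib2.
    have := integrable_fin_num (measurable_itv _) ib1z.
    have := integrable_fin_num (measurable_itv _) ib2z.
    move: Ffin; move: (cdf X z) (integral _ _ _) (integral _ _ _)
      (integral _ _ _) (integral _ _ _).
    move=> [f| |] [p| |] [q| |] [r| |] [s| |] //= _ _ _ _ _.
    by rewrite -!EFinM -?EFinD; congr EFin; ring.
  by split; split; rewrite ?dBE// cov_gtN.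
- move=> _ ac.
  rewrite (@integral_cov_kernel_derive1 _ _ _ _ X z b1 b2)//.
  by split; split; rewrite ?cov_le// cov_gtN.
Qed.
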